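(* Let $m,n$ be positive integers and let $A\in\mathbb{Z}^{m\times n}$ be a nonzero matrix. If $\|A\|_\infty\in\{1,2\}$, then $\omega(A)=0$ or $\omega(A)=1$. If $\|A\|_\infty\ge 3$, then $$\omega(A)\le (\|A\|_\infty-1)^{\operatorname{rank}A}.$$ The latter bound is sharp: for every integer $k\ge 2$ and every integer $r\ge 1$ there exists an integer matrix $A$ with $\|A\|_\infty=k+1$, $\operatorname{rank}A=r$ and $\omega(A)=k^{r}$.
   Context: For $A=[a_{ij}]\in\mathbb{R}^{m\times n}$, $\|A\|_\infty:=\max_i\sum_{j=1}^n|a_{ij}|$, and $N(A)=\{\mathbf{x}\in\mathbb{R}^n: A\mathbf{x}=\mathbf{0}\}$ is the real nullspace. For a nonzero vector $\mathbf{x}=(x_1,\ldots,x_n)^\top\in\mathbb{R}^n$, the relative magnitude of $\mathbf{x}$ is $$\omega(\mathbf{x})=\max\left\{\frac{|x_j|}{|x_i|} : i,j\in\{1,\ldots,n\},\ x_i\neq 0\right\}.$$ The solution relative magnitude of $A$ is $\omega(A)=\inf\{\omega(\mathbf{x}) : \mathbf{x}\in N(A)\setminus\{\mathbf{0}\}\}$ if $N(A)\ne\{\mathbf{0}\}$, and $\omega(A)=0$ if $N(A)=\{\mathbf{0}\}$. *)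

(* Defs.v *)
From HB Require Import structures.
From mathcomp Require Import all_boot all_order all_algebra.
From mathcomp Require Import all_classical all_reals.

Set Implicit Arguments.
Unset Strict Implicit.
Unset Printing Implicit Defensive.

Import Order.TTheory GRing.Theory Num.Theory.
Local Open Scope classical_set_scope.
Local Open Scope ring_scope.

(* In both maxima below all terms are nonnegative, so the default value 0
   only matters when the index set is empty, i.e. m = 0, resp. x = 0. *)
Definition norm_infty (R : realType) (m n : nat) (A : 'M[R]_(m, n)) : R :=
  \big[Num.max/0]_(i < m) \sum_(j < n) `|A i j|.

Definition nullspace (R : realType) (m n : nat) (A : 'M[R]_(m, n)) :
    set 'cV[R]_n :=
  [set x | A *m x = 0].

Definition rel_magnitude (R : realType) (n : nat) (x : 'cV[R]_n) : R :=
  \big[Num.max/0]_(p : 'I_n * 'I_n | x p.1 0 != 0)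
    (`|x p.2 0| / `|x p.1 0|).

Definition sol_rel_magnitude (R : realType) (m n : nat)
    (A : 'M[R]_(m, n)) : R :=
  if pselect (nullspace A = [set 0]) then 0
  else inf [set rel_magnitude x | x in nullspace A `\ 0].

Definition real_mx (R : realType) (m n : nat) (A : 'M[int]_(m, n)) :
    'M[R]_(m, n) :=
  map_mx intr A.

(* Main.v *)
Require Import Defs.
From HB Require Import structures.
From mathcomp Require Import all_boot all_order all_algebra.
From mathcomp Require Import all_classical all_reals.

Set Implicit Arguments.
Unset Strict Implicit.
Unset Printing Implicit Defensive.

Import Order.TTheory GRing.Theory Num.Theory.
Local Open Scope ring_scope.

(** Upper bound.  Let k + 1 bound the row sums of absolute values of the integer
    matrix A, with k >= 1, and suppose that A has a nonzero null vector.
    Deleting columns as long as a nonzero null vector survives leads to columns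
    of A that carry a null vector x without zero entry and whose rank is one
    less than their number; keeping a maximal independent set of their rows
    gives a row-free r x (r + 1) matrix B with B x = 0, where r <= \rank A
    (exists_small_ratio_nullvector).  Cramer's rule says that the entries of x
    are proportional to the maximal minors of B.  The minor in the denominator
    is a nonzero integer, so of absolute value at least 1
    (full_support_ratio_le).

    It remains to bound the minors of B by k ^ r rather than by the obvious
    (k + 1) ^ r.  By integrality, a row of B has weight more than k on the
    columns of a minor only if it vanishes on all the other columns.  If s >= 1
    rows all vanished outside of the same s columns, they would form on these
    columns a square matrix that is invertible, as the rows of B are
    independent, and singular, as it kills the corresponding part of x.  Hence among any s >= 1 rows, restricted
    to any s columns, some row has weight at most k
    (sparse_row_of_full_support).  Laplace expansion along such a row costs a
    factor k, and the condition is inherited by the smaller minors, so that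
    the bound k ^ r follows by induction (norm_det_le_exp).

    Since the relative magnitude of a nonzero vector is at least 1, taking
    k = 1 shows that norms 1 and 2 leave only the values 0 and 1.

    Sharpness.  The equations x_(i+1) = k x_i, for 0 <= i < r, have row weight
    k + 1, and their solutions are the multiples of (1, k, ..., k ^ r). *)

(** * Minors of integer matrices with a null vector of full support *)

(** Expanding along the row provided by the hypothesis for the full index sets
    costs a factor [k]; the hypothesis quantifies over all square submatrices so
    that the minors occurring in the expansion satisfy it again. *)
Lemma norm_det_le_exp (F : realDomainType) (k : F) (s : nat) (M : 'M[F]_s) :
  (forall S T : {set 'I_s}, (0 < #|S|)%N -> #|S| = #|T| ->
     exists2 i, i \in S & \sum_(j in T) `|M i j| <= k) ->
  `|\det M| <= k ^+ s.
Proof.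
elim: s M => [|s IHs] M hallM; first by rewrite det_mx00 normr1 expr0.
have [|i _ rowi] := hallM finset.setT finset.setT _ erefl.
  by rewrite cardsT card_ord.
have {}rowi : \sum_j `|M i j| <= k.
  by move: rowi; rewrite (eq_bigl predT) // => j; rewrite finset.in_setT.
have k_ge0 : 0 <= k by apply: le_trans rowi; apply: sumr_ge0.
rewrite (expand_det_row M i); apply: le_trans (ler_norm_sum _ _ _) _.
apply: (@le_trans _ _ (\sum_j `|M i j| * k ^+ s)); last first.
  by rewrite -mulr_suml exprS ler_wpM2r ?exprn_ge0.
apply: ler_sum => j _; rewrite normrM ler_wpM2l // normrMsign.
apply: IHs => S T S_gt0 cardST.
have [||_ /imsetP[a aS ->] rowa] := hallM (lift i @: S) (lift j @: T).
- by rewrite card_imset //; apply: lift_inj.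
- by rewrite !card_imset //; apply: lift_inj.
exists a => //; apply: le_trans rowa.
rewrite big_imset /=; last by move=> b c _ _; apply: lift_inj.
by under eq_bigr do rewrite !mxE.
Qed.

(** Otherwise, by integrality, the rows in [S] would vanish outside of [T].  The
    block of [B] on [S] and [T] would then be square with independent rows,
    hence invertible, although it kills the nonzero restriction of [x] to
    [T]. *)
Lemma sparse_row_of_full_support (R : archiRealFieldType) (k : R) (r n : nat)
    (B : 'M[R]_(r, n)) (x : 'cV[R]_n) (S : {set 'I_r}) (T : {set 'I_n}) :
    (forall i j, B i j \is a Num.int) ->
    (forall i, \sum_j `|B i j| <= k + 1) ->
    row_free B -> B *m x = 0 -> (forall j, x j 0 != 0) ->
    (0 < #|S|)%N -> #|S| = #|T| ->
  exists2 i, i \in S & \sum_(j in T) `|B i j| <= k.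
Proof.
move=> Bint rowB freeB Bx0 x_neq0 S_gt0 cardST.
apply/exists_inP; apply: contraT => /exists_inPn bigS.
have out0 i j : i \in S -> j \notin T -> B i j = 0.
  move=> iS jT; apply/eqP; apply: contraT => Bij.
  move: (rowB i); rewrite (bigID (mem T)) /= leNgt => /negP[].
  apply: ltr_leD; first by rewrite ltNge bigS.
  apply: le_trans (norm_intr_ge1 (Bint i j) Bij) _.
  by rewrite (bigD1 j) //= lerDl sumr_ge0.
pose eS : 'I_#|S| -> 'I_r := enum_val; pose eT : 'I_#|T| -> 'I_n := enum_val.
pose D := mxsub eS eT B.
have BE p (V : 'M_(n, p)) : rowsub eS (B *m V) = D *m rowsub eT V.
  apply/matrixP => a c; rewrite !mxE (bigID (mem T)) /= [X in _ + X]big1 ?addr0.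
    by rewrite big_enum_val; apply: eq_bigr => b _; rewrite !mxE.
  by move=> j jT; rewrite out0 ?mul0r //; apply: enum_valP.
have freeD : row_free D.
  have [W BW1] := row_freeP freeB.
  apply/row_freeP; exists (rowsub eT (W *m colsub eS 1%:M)).
  rewrite -BE mulmxA BW1 mul1mx; apply/matrixP => a b; rewrite !mxE.
  by rewrite (inj_eq enum_val_inj).
have /row_fullP[D' D'D] : row_full D by rewrite /row_full (eqP freeD) cardST.
have xT0 : rowsub eT x = 0.
  by rewrite -[LHS]mul1mx -D'D -mulmxA -BE Bx0 rowsubE !mulmx0.
have T_gt0 : (0 < #|T|)%N by rewrite -cardST.
move/matrixP/(_ (Ordinal T_gt0) 0)/eqP: xT0.
by rewrite !mxE (negPf (x_neq0 _)).
Qed.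

(** Cramer's rule: adding on top of [B] the row that reads off the [i]-th entry
    gives an invertible matrix [C] with [C *m x] equal to [x i 0] times the first
    basis vector, so [\det C * x j 0] is [x i 0] times a maximal minor of [B]. *)
Lemma full_support_ratio_le (R : archiRealFieldType) (k : R) (r : nat)
    (B : 'M[R]_(r, r.+1)) (x : 'cV[R]_r.+1) :
    (forall i j, B i j \is a Num.int) ->
    (forall i, \sum_j `|B i j| <= k + 1) ->
    row_free B -> B *m x = 0 -> (forall j, x j 0 != 0) ->
  forall i j, `|x j 0| <= k ^+ r * `|x i 0|.
Proof.
move=> Bint rowB freeB Bx0 x_neq0 i j.
pose C : 'M[R]_r.+1 := col_mx (delta_mx 0 i : 'rV_r.+1) B.
have Cx : C *m x = x i 0 *: delta_mx 0 0.
  rewrite [C *m x](mul_col_mx (delta_mx 0 i : 'rV_r.+1) B x) Bx0 -rowE.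
  apply/matrixP => a c; rewrite ord1 [RHS]mxE [delta_mx _ _ _ _]mxE eqxx andbT.
  case: (@split_ordP 1 r a) => b ->.
    by rewrite (@col_mxEu _ 1 r) ord1 mxE -val_eqE mulr1.
  by rewrite (@col_mxEd _ 1 r) mxE -val_eqE /= mulr0.
(* A row vector (a, w) killing C satisfies a e_i + w B = 0; multiplying by x
   gives a x_i = 0, so a = 0, and then w = 0 as B is row-free. *)
have detC_neq0 : \det C != 0.
  apply/negP => /det0P[v v_neq0 vC0]; case/negP: v_neq0.
  rewrite -(@hsubmxK R 1 1 r v) in vC0 *.
  set a := lsubmx _ in vC0 *; set w := rsubmx _ in vC0 *.
  move: vC0; rewrite [X in X = _](mul_row_col a w (delta_mx 0 i : 'rV_r.+1) B) => vC0.
  have a0 : a = 0.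
    have: (a *m (delta_mx 0 i : 'rV_r.+1) + w *m B) *m x = 0 by rewrite vC0 mul0mx.
    rewrite mulmxDl -!mulmxA Bx0 mulmx0 addr0 -rowE [a]mx11_scalar mul_scalar_mx.
    move/matrixP/(_ 0 0)/eqP; rewrite !mxE mulf_eq0 (negPf (x_neq0 i)) orbF => /eqP->.
    by rewrite raddf0.
  move: vC0; rewrite a0 mul0mx add0r => wB0.
  have [W BW1] := row_freeP freeB.
  by rewrite -[w]mulmx1 -BW1 mulmxA wB0 mul0mx row_mx0.
have Cint a b : C a b \is a Num.int.
  rewrite /C; case: (@split_ordP 1 r a) => c ->.
    by rewrite (@col_mxEu _ 1 r) mxE natr_int.
  by rewrite (@col_mxEd _ 1 r).
have detC_int : \det C \is a Num.int.
  by rewrite rpred_sum // => s _; rewrite rpredMsign rpred_prod.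
have cramer : \det C * x j 0 = x i 0 * cofactor C 0 j.
  have := congr1 (mulmx (\adj C)) Cx.
  rewrite mulmxA mul_adj_mx mul_scalar_mx -scalemxAr -colE.
  by move/matrixP/(_ j 0); rewrite !mxE.
have minorE : row' 0 (col' j C) = col' j B.
  apply/matrixP => a b; rewrite !mxE; case: (@split_ordP 1 r) => c //.
    by move/(congr1 val); rewrite /= ord1.
  by move/(congr1 val) => /= [] /val_inj ->.
have cof_le : `|cofactor C 0 j| <= k ^+ r.
  rewrite normrMsign minorE; apply: norm_det_le_exp => S T S_gt0 cardST.
  have cardT : #|S| = #|lift j @: T| by rewrite card_imset //; apply: lift_inj.
  have [a aS rowa] :=
    sparse_row_of_full_support Bint rowB freeB Bx0 x_neq0 S_gt0 cardT.
  exists a => //; apply: le_trans rowa.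
  rewrite big_imset /=; last by move=> b c _ _; apply: lift_inj.
  by under eq_bigr do rewrite mxE.
apply: (@le_trans _ _ (`|\det C| * `|x j 0|)).
  by rewrite ler_peMl ?norm_intr_ge1.
by rewrite -normrM cramer normrM mulrC ler_wpM2r.
Qed.

(** * From full support to arbitrary matrices *)

Lemma mxrank_colsub_le (F : fieldType) (m n p : nat) (f : 'I_p -> 'I_n)
    (A : 'M[F]_(m, n)) : (\rank (colsub f A) <= \rank A)%N.
Proof. by rewrite -[A in colsub f A]mulmx1 -mulmx_colsub mxrankM_maxl. Qed.

Lemma nullvector_of_rank_lt (F : fieldType) (m n : nat) (A : 'M[F]_(m, n)) :
  (\rank A < n)%N -> exists2 x : 'cV_n, x != 0 & A *m x = 0.
Proof.
move=> rkA; have : kermx A^T != 0.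
  by rewrite kermx_eq0 /row_free mxrank_tr neq_ltn rkA.
case/rowV0Pn => v /sub_kermxP vA v_neq0; exists v^T; first by rewrite trmx_eq0.
by apply: trmx_inj; rewrite trmx_mul trmxK vA trmx0.
Qed.

Lemma rank_lt_of_nullvector (F : fieldType) (m n : nat) (A : 'M[F]_(m, n))
    (x : 'cV_n) : x != 0 -> A *m x = 0 -> (\rank A < n)%N.
Proof.
move=> x_neq0 Ax0; rewrite ltn_neqAle rank_leq_col andbT.
apply: contra x_neq0 => /row_fullP[W WA].
by rewrite -[x]mul1mx -WA -mulmxA Ax0 mulmx0.
Qed.

(** Induction on the number of columns.  If [y] has a zero entry, or if the rank
    is small enough for the other columns to be dependent, a column can be
    dropped, and a null vector found for the rest is extended by zero.  In the
    remaining case [y] itself satisfies the bound, by [full_support_ratio_le]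
    applied to a maximal independent set of rows.  The assumption [1 <= k]
    makes the bound monotone in the rank, which may drop with the columns. *)
Lemma exists_small_ratio_nullvector (R : archiRealFieldType) (k : R) (m n : nat)
    (A : 'M[R]_(m, n)) (y : 'cV[R]_n) :
    1 <= k -> (forall i j, A i j \is a Num.int) ->
    (forall i, \sum_j `|A i j| <= k + 1) ->
    y != 0 -> A *m y = 0 ->
  exists x : 'cV[R]_n, [/\ x != 0, A *m x = 0 &
    forall i j, x i 0 != 0 -> `|x j 0| <= k ^+ \rank A * `|x i 0|].
Proof.
move=> k_ge1; elim: n A y => [|n IHn] A y Aint rowA y_neq0 Ay0.
  by rewrite [y]flatmx0 eqxx in y_neq0.
have drop_col i (z : 'cV_n) : z != 0 -> col' i A *m z = 0 ->
  exists x : 'cV[R]_n.+1, [/\ x != 0, A *m x = 0 &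
    forall i j, x i 0 != 0 -> `|x j 0| <= k ^+ \rank A * `|x i 0|].
  move=> z_neq0 Az0.
  have row_col' a : \sum_j `|col' i A a j| <= k + 1.
    apply: le_trans (rowA a); rewrite (bigD1_ord i) //=.
    by under eq_bigr do rewrite mxE; rewrite lerDr.
  have int_col' a b : col' i A a b \is a Num.int by rewrite mxE.
  have [w [w_neq0 Aw0 ratio_w]] := IHn _ z int_col' row_col' z_neq0 Az0.
  pose x : 'cV[R]_n.+1 := \col_j oapp (fun b => w b 0) 0 (unlift i j).
  have xi : x i 0 = 0 by rewrite mxE unlift_none.
  have xlift b : x (lift i b) 0 = w b 0 by rewrite mxE liftK.
  exists x; split.
  - apply: contra w_neq0 => /eqP x0; apply/eqP/matrixP => b c.
    by rewrite ord1 -xlift x0 !mxE.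
  - apply/matrixP => a c; rewrite ord1 [RHS]mxE mxE (bigD1_ord i) //= xi mulr0 add0r.
    move/matrixP/(_ a 0): Aw0; rewrite !mxE => Aw0a; rewrite -[RHS]Aw0a.
    by apply: eq_bigr => b _; rewrite xlift mxE.
  - move=> a b; have [a' ->|->] := unliftP i a; last by rewrite xi eqxx.
    rewrite xlift => wa.
    have [b' ->|->] := unliftP i b; last first.
      by rewrite xi normr0 mulr_ge0 // exprn_ge0 // (le_trans ler01).
    rewrite xlift; apply: le_trans (ratio_w _ _ wa) _.
    by rewrite ler_wpM2r // ler_weXn2l // mxrank_colsub_le.
have [/existsP[i /eqP yi0]|/existsPn y_full] := boolP [exists i, y i 0 == 0].
  apply: (drop_col i (row' i y)).
    apply: contra y_neq0 => /eqP y'0; apply/eqP/matrixP => a c.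
    rewrite ord1; have [b ->|->] := unliftP i a; last by rewrite yi0 mxE.
    by move/matrixP/(_ b 0): y'0; rewrite !mxE.
  apply/matrixP => a c; rewrite ord1; move/matrixP/(_ a 0): Ay0.
  rewrite !mxE (bigD1_ord i) //= yi0 mulr0 add0r => Ay0a; rewrite -[RHS]Ay0a.
  by apply: eq_bigr => b _; rewrite !mxE.
have := rank_lt_of_nullvector y_neq0 Ay0; rewrite ltnS leq_eqVlt.
case/orP => [/eqP rkA|rkA]; last first.
  have [|z z_neq0 Az0] := @nullvector_of_rank_lt _ _ _ (col' ord0 A).
    by apply: leq_ltn_trans rkA; apply: mxrank_colsub_le.
  exact: drop_col z_neq0 Az0.
have : exists f : 'I_(\rank A) -> 'I_m, row_free (rowsub f A).
  by exists (maxrankfun A); apply: maxrowsub_free.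
rewrite rkA => -[f freeB]; exists y; split=> // i j _.
apply: (full_support_ratio_le (B := rowsub f A)) => // [a b|a|].
- by rewrite mxE.
- by under eq_bigr do rewrite mxE.
- by rewrite mul_rowsub_mx Ay0 rowsubE mulmx0.
Qed.

(** * Relative magnitudes *)

Section RelativeMagnitude.
Variable R : realType.

Lemma ratio_le_rel_magnitude (n : nat) (x : 'cV[R]_n) (i j : 'I_n) :
  x i 0 != 0 -> `|x j 0| / `|x i 0| <= rel_magnitude x.
Proof.
exact: (@le_bigmax_cond _ R _ 0 (i, j) (fun p => x p.1 0 != 0)
          (fun p => `|x p.2 0| / `|x p.1 0|)).
Qed.

Lemma rel_magnitude_ge1 (n : nat) (x : 'cV[R]_n) :
  x != 0 -> 1 <= rel_magnitude x.
Proof.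
case/matrix0Pn => i [c]; rewrite ord1 => xi.
apply: le_trans (ratio_le_rel_magnitude i xi).
by rewrite divff // normr_eq0.
Qed.

Lemma rel_magnitude_le (n : nat) (x : 'cV[R]_n) (b : R) : 0 <= b ->
  (forall i j, x i 0 != 0 -> `|x j 0| <= b * `|x i 0|) ->
  rel_magnitude x <= b.
Proof.
move=> b_ge0 ratio_x; apply: bigmax_le => //= p xp.
by rewrite ler_pdivrMr ?normr_gt0 // ratio_x.
Qed.

Lemma norm_infty_row_le (m n : nat) (A : 'M[R]_(m, n)) (i : 'I_m) :
  \sum_j `|A i j| <= norm_infty A.
Proof. exact: (le_bigmax_cond _ (fun i => \sum_j `|A i j|)). Qed.

Lemma lbound_rel_magnitude (m n : nat) (A : 'M[R]_(m, n)) :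
  lbound [set rel_magnitude x | x in nullspace A `\ 0]%classic 1.
Proof. by move=> _ [x [_ /eqP x_neq0] <-]; apply: rel_magnitude_ge1. Qed.

Lemma exists_nullvector (m n : nat) (A : 'M[R]_(m, n)) :
  nullspace A <> [set 0]%classic -> exists2 x : 'cV_n, x != 0 & A *m x = 0.
Proof.
move=> NA; have [//|noX] := pselect (exists2 x : 'cV_n, x != 0 & A *m x = 0).
case: NA; apply/seteqP; split=> [x Ax0|_ ->]; last exact: mulmx0.
by apply/eqP; apply: contra_notT noX => x_neq0; exists x.
Qed.

(** The parameter [k] is not tied to [norm - 1], so that [k = 1] also covers
    matrices of norm 1, for which [norm - 1] would be 0. *)
Lemma sol_rel_magnitude_bounds (m n : nat) (A : 'M[int]_(m, n)) (k : R) :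
    1 <= k -> norm_infty (real_mx R A) <= k + 1 ->
  sol_rel_magnitude (real_mx R A) = 0 \/
  1 <= sol_rel_magnitude (real_mx R A) <= k ^+ \rank (real_mx R A).
Proof.
move=> k_ge1 normA; rewrite /sol_rel_magnitude; case: pselect => NA; first by left.
right; have [y y_neq0 Ay0] := exists_nullvector NA.
have [x [x_neq0 Ax0 ratio_x]] : exists x : 'cV[R]_n, [/\ x != 0,
    real_mx R A *m x = 0 & forall i j, x i 0 != 0 ->
      `|x j 0| <= k ^+ \rank (real_mx R A) * `|x i 0|].
  apply: (exists_small_ratio_nullvector k_ge1 _ _ y_neq0 Ay0) => [i j|i].
    by rewrite mxE intr_int.
  exact: le_trans (norm_infty_row_le _ i) normA.
have imx : [set rel_magnitude x | x in nullspace (real_mx R A) `\ 0]%classic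
             (rel_magnitude x).
  by exists x => //; split=> //; apply/eqP.
apply/andP; split.
  by apply: lb_le_inf; [exists (rel_magnitude x) | apply: lbound_rel_magnitude].
apply: le_trans (ge_inf _ imx) _; first by exists 1; apply: lbound_rel_magnitude.
by apply: rel_magnitude_le => //; rewrite exprn_ge0 // (le_trans ler01).
Qed.

(** * Sharpness *)

(** The coefficient matrix of the equations [k * x_i - x_(i+1) = 0]. *)
Definition geometric_mx (k r : nat) : 'M[int]_(r, r.+1) :=
  \matrix_(i, j) (k%:R * (j == widen_ord (leqnSn r) i)%:R - (j == lift ord0 i)%:R).

Lemma geometric_mxE (k r : nat) i j : real_mx R (geometric_mx k r) i j =
  k%:R * (j == widen_ord (leqnSn r) i)%:R - (j == lift ord0 i)%:R.
Proof. by rewrite !mxE rmorphB rmorphM /= !rmorph_nat. Qed.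

Lemma norm_geometric_mx (k r : nat) : (0 < r)%N ->
  norm_infty (real_mx R (geometric_mx k r)) = k%:R + 1.
Proof.
move=> r_gt0.
have rowE i : \sum_j `|real_mx R (geometric_mx k r) i j| = k%:R + 1.
  transitivity (\sum_j (k%:R * (j == widen_ord (leqnSn r) i)%:R
                        + (j == lift ord0 i)%:R : R)).
    apply: eq_bigr => j _; rewrite geometric_mxE.
    case: eqP => [->|_]; last by rewrite mulr0 !add0r normrN normr_nat.
    rewrite -val_eqE /= /bump /= add1n (ltn_eqF (ltnSn i)) subr0 addr0.
    by rewrite mulr1 normr_nat.
  rewrite big_split /= -mulr_sumr -!natr_sum -!big_mkcond /=.
  by rewrite !big_pred1_eq mulr1.
apply/eqP; rewrite eq_le; apply/andP; split.
  by apply: bigmax_le => [|i _]; rewrite ?rowE // addr_ge0.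
by rewrite -(rowE (Ordinal r_gt0)); apply: norm_infty_row_le.
Qed.

Lemma rank_geometric_mx (k r : nat) : \rank (real_mx R (geometric_mx k r)) = r.
Proof.
apply/eqP; rewrite eqn_leq rank_leq_row /=.
(* Without its first column the matrix is lower triangular with diagonal
   entries -1. *)
set A := real_mx R _; suff {1}<- : \rank (col' ord0 A) = r by apply: mxrank_colsub_le.
have entryE i j : col' ord0 A i j = k%:R * (j.+1 == i)%:R - (j == i)%:R.
  by rewrite mxE geometric_mxE (inj_eq lift_inj) -val_eqE.
apply/mxrank_unit; rewrite unitmxE det_trig.
  rewrite unitfE; apply/prodf_neq0 => i _; rewrite entryE eqxx.
  by rewrite gtn_eqF // mulr0 sub0r oppr_eq0 oner_eq0.
apply/is_trig_mxP => i j ltij; rewrite entryE -val_eqE /=.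
by rewrite !gtn_eqF ?mulr0 ?subr0 // ltnW.
Qed.

Lemma nullspace_geometric_mxP (k r : nat) (x : 'cV[R]_r.+1) :
  real_mx R (geometric_mx k r) *m x = 0 <->
  forall j, x j 0 = k%:R ^+ j * x 0 0.
Proof.
have rowE i : (real_mx R (geometric_mx k r) *m x) i 0 =
    k%:R * x (widen_ord (leqnSn r) i) 0 - x (lift ord0 i) 0.
  rewrite mxE; under eq_bigr do rewrite geometric_mxE mulrBl -mulrA.
  rewrite sumrB -mulr_sumr; congr (_ * _ - _).
    rewrite (bigD1 (widen_ord (leqnSn r) i)) //= eqxx mul1r big1 ?addr0 //.
    by move=> j /negPf->; rewrite mul0r.
  rewrite (bigD1 (lift ord0 i)) //= eqxx mul1r big1 ?addr0 //.
  by move=> j /negPf->; rewrite mul0r.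
split=> [Ax0 [j ltj]|xE].
  elim: j ltj => [|j IHj] ltj.
    by rewrite expr0 mul1r; congr (x _ _); apply: val_inj.
  move/matrixP/(_ (Ordinal (ltj : (j < r)%N)) 0): Ax0; rewrite rowE mxE => /eqP.
  rewrite subr_eq0 => /eqP stepE; rewrite exprS -mulrA -(IHj (ltnW ltj)).
  by transitivity (x (lift ord0 (Ordinal (ltj : (j < r)%N))) 0);
    [|rewrite -stepE; congr (_ * _)]; congr (x _ _); apply: val_inj.
apply/matrixP => i c; rewrite ord1 rowE mxE (xE (lift ord0 i)) (xE (widen_ord _ i)).
by rewrite mulrA -exprS subrr.
Qed.

Lemma sol_rel_magnitude_geometric_mx (k r : nat) : (0 < k)%N ->
  sol_rel_magnitude (real_mx R (geometric_mx k r)) = k%:R ^+ r.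
Proof.
move=> k_gt0; have k_ge1 : 1 <= k%:R :> R by rewrite ler1n.
have k_ge0 : 0 <= k%:R :> R by [].
have kX_gt0 j : 0 < k%:R ^+ j :> R by rewrite exprn_gt0 // ltr0n.
have magE x : x != 0 -> real_mx R (geometric_mx k r) *m x = 0 ->
    rel_magnitude x = k%:R ^+ r.
  move=> x_neq0 /nullspace_geometric_mxP xE.
  have x0_neq0 : x 0 0 != 0.
    apply: contra x_neq0 => /eqP x0; apply/eqP/matrixP => j c.
    by rewrite ord1 xE x0 mulr0 mxE.
  apply/eqP; rewrite eq_le; apply/andP; split.
    apply: rel_magnitude_le => [|i j _]; first exact: ltW.
    rewrite (xE i) (xE j) !normrM !normrX !normr_nat mulrA ler_wpM2r //.
    apply: (@le_trans _ _ (k%:R ^+ r)); first by rewrite ler_weXn2l // -ltnS.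
    by rewrite ler_peMr ?exprn_ege1 // ltW.
  apply: le_trans (ratio_le_rel_magnitude ord_max x0_neq0).
  by rewrite (xE ord_max) normrM normrX normr_nat mulfK // normr_eq0.
pose v : 'cV[R]_r.+1 := \col_j k%:R ^+ j.
have v_neq0 : v != 0.
  by apply/matrix0Pn; exists 0, 0; rewrite mxE expr0 oner_eq0.
have Av0 : real_mx R (geometric_mx k r) *m v = 0.
  by apply/nullspace_geometric_mxP => j; rewrite !mxE mulr1.
rewrite /sol_rel_magnitude; case: pselect => /= [NA|_].
  have : nullspace (real_mx R (geometric_mx k r)) v by [].
  by rewrite NA => /= v0; rewrite v0 eqxx in v_neq0.
rewrite -[RHS]inf1; congr inf; apply/seteqP.
split=> b /= => [[x [Ax0 /eqP x_neq0] <-]|->].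
  exact: magE.
by exists v; [split=> //; apply/eqP | apply: magE].
Qed.

End RelativeMagnitude.

Theorem theorem1p1 (R : realType) :
  (forall (m n : nat) (A : 'M[int]_(m, n)),
     (0 < m)%N -> (0 < n)%N -> A != 0 ->
     (norm_infty (real_mx R A) = 1 \/ norm_infty (real_mx R A) = 2 ->
        sol_rel_magnitude (real_mx R A) = 0 \/
        sol_rel_magnitude (real_mx R A) = 1) /\
     (3 <= norm_infty (real_mx R A) ->
        sol_rel_magnitude (real_mx R A)
          <= (norm_infty (real_mx R A) - 1) ^+ \rank (real_mx R A))) /\
  (forall k r : nat, (2 <= k)%N -> (1 <= r)%N ->
     exists (m n : nat) (A : 'M[int]_(m, n)),
       [/\ (0 < m)%N, (0 < n)%N,
           norm_infty (real_mx R A) = k%:R + 1,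
           \rank (real_mx R A) = r
         & sol_rel_magnitude (real_mx R A) = k%:R ^+ r]).
Proof.
split=> [m n A _ _ _|k r k_ge2 r_ge1]; last first.
  exists r, r.+1, (geometric_mx k r); split=> //.
  - exact: norm_geometric_mx.
  - exact: rank_geometric_mx.
  - by apply: sol_rel_magnitude_geometric_mx; apply: ltnW.
split=> [normA|norm_ge3].
  have [||->|/andP[ge1 le1]] := @sol_rel_magnitude_bounds R _ _ A 1; rewrite ?lexx //.
  - by case: normA => ->; rewrite -?[2]/(1 + 1) ?lerDl ?ler01 ?lexx.
  - by left.
  - by right; apply/eqP; rewrite eq_le ge1 andbT; rewrite expr1n in le1.
have k_ge1 : 1 <= norm_infty (real_mx R A) - 1.
  by rewrite lerBrDr; apply: le_trans norm_ge3; rewrite -[1 + 1]/(2%:R) ler_nat.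
have [|->|/andP[] //] := sol_rel_magnitude_bounds k_ge1 (A := A).
  by rewrite subrK.
by rewrite exprn_ge0 // (le_trans ler01).
Qed.
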